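(* Let $\mathbf{G}$ be a finite abelian group with underlying set $G$. Then $\mathbf{G}$ has finitely many expansions up to term equivalence (equivalently, the lattice of all clones on $G$ containing $\mathrm{Clo}(G,+,-,0)$ is finite) if and only if $\mathbf{G}$ is of squarefree order.
   Context: A clone on a set $A$ is a set of finitary functions $A^n\to A$ ($n\geq 1$) containing all projections and closed under composition. $\mathrm{Clo}(G,+,-,0)$ is the clone of term operations of the group, i.e. the clone on $G$ generated by the group operations. An expansion of $\mathbf{G}$ is an algebra on $G$ obtained by adding further finitary operations to those of $\mathbf{G}$; two such expansions are term equivalent if they have the same clone of term operations. *)

(* Defs.v *)
From HB Require Import structures.
From mathcomp Require Import all_boot all_order all_algebra.
From mathcomp Require Import boolp classical_sets functions cardinality.

Set Implicit Arguments.
Unset Strict Implicit.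
Unset Printing Implicit Defensive.

Import GRing.Theory.
Local Open Scope classical_set_scope.
Local Open Scope ring_scope.

Definition op (T : Type) (n : nat) : Type := ('I_n -> T) -> T.

(* Clones only contain operations of positive arity: the component of index n *)
(* of such a family is a set of operations of arity n + 1.                    *)
Definition opfam (T : Type) : Type := forall n : nat, set (op T n.+1).

Definition opfam_sub (T : Type) (C D : opfam T) : Prop :=
  forall n, C n `<=` D n.

Definition proj (T : Type) (n : nat) (i : 'I_n) : op T n := fun x => x i.

Definition compose (T : Type) (m n : nat) (f : op T m) (g : 'I_m -> op T n) :
  op T n := fun x => f (fun i => g i x).

Definition is_clone (T : Type) (C : opfam T) : Prop :=
  (forall n (i : 'I_n.+1), C n (proj i)) /\
  (forall m n (f : op T m.+1) (g : 'I_m.+1 -> op T n.+1),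
     C m f -> (forall i, C n (g i)) -> C n (compose f g)).

(* Fundamental operations may be nullary, as the constant 0 of a group is.    *)
Record algebra (T : Type) : Type := Algebra {
  symbol : Type;
  arity : symbol -> nat;
  interp : forall s : symbol, op T (arity s) }.
Arguments interp {T} a s.

Inductive term (T : Type) (A : algebra T) (n : nat) : Type :=
| Var (i : 'I_n)
| App (s : symbol A) (args : 'I_(arity s) -> term A n).
Arguments Var {T A n} i.
Arguments App {T A n} s args.

Fixpoint term_op (T : Type) (A : algebra T) (n : nat) (t : term A n) :
  op T n :=
  match t with
  | Var i => proj i
  | App s args => compose (interp A s) (fun j => term_op (args j))
  end.

(* A nullary fundamental operation contributes to term_clone the constant     *)
(* operations of every positive arity.                                        *)
Definition term_clone (T : Type) (A : algebra T) : opfam T :=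
  fun n => [set f | exists t : term A n.+1, term_op t = f].

Definition term_equiv (T : Type) (A B : algebra T) : Prop :=
  term_clone A = term_clone B.

Definition expand (T : Type) (A X : algebra T) : algebra T :=
  {| symbol := symbol A + symbol X;
     arity := fun s => match s with inl a => arity a | inr b => arity b end;
     interp := fun s => match s with inl a => interp A a | inr b => interp X b end |}.

Inductive group_symbol : Type := Add | Opp | Zero.

Definition group_arity (s : group_symbol) : nat :=
  match s with Add => 2 | Opp => 1 | Zero => 0 end.

Definition group_interp (G : zmodType) (s : group_symbol) :
  op G (group_arity s) :=
  match s with
  | Add => fun x : 'I_2 -> G => x ord0 + x ord_max
  | Opp => fun x : 'I_1 -> G => - x ord0
  | Zero => fun _ : 'I_0 -> G => 0
  end.

Definition group_algebra (G : zmodType) : algebra G :=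
  Algebra (@group_interp G).

(* Expansions form a large collection, so finiteness up to term equivalence   *)
(* is the existence of a finite complete list of representatives.             *)
Definition finitely_many_expansions (T : Type) (A : algebra T) : Prop :=
  exists (k : nat) (F : 'I_k -> algebra T),
    forall X : algebra T, exists i : 'I_k,
      term_equiv (expand A X) (expand A (F i)).

Definition clones_above (T : Type) (D : opfam T) : set (opfam T) :=
  [set C | is_clone C /\ opfam_sub D C].

Definition squarefree (n : nat) : Prop :=
  forall d : nat, (d ^ 2 %| n)%N -> d = 1%N.

(* Main.v *)
(* If p^2 divides |G|, there are a surjection h : G -> F_p and an embedding i of
   F_p into ker h; the operations i (h x_1 ... h x_k) generate with + clones of
   degree at most k, so that the chain of clones is infinite.

   If |G| is squarefree, a clone C above Clo(G, +, -, 0) is determined by its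
   operations of arity |G| + 1. It suffices to consider operations with values
   in one primary component F_p of G = F_p + H. Such an operation f (x, y), with
   x over F_p and y over H, is a sum of monomials x^a r(y). The automorphisms
   x |-> c x of F_p separate the monomials, so each lies in C, and by
   polarization and identification of variables x^a r(y) may be replaced with
   x_1 ... x_d r(y), where d is the total degree of a. As p does not divide |H|,
   averaging over the lines of F_q^2 shows that r is an F_p-combination of
   functions u (b . y) with u unary and x_1 ... x_d u(y) in C. Finally, since
   u^p = u and x^p = x, membership of x_1 ... x_d u(y) in C only depends on d
   modulo p - 1 once d >= 2, so that the case d <= p suffices. *)
From HB Require Import structures.
Require Import Defs.
From mathcomp Require Import all_boot all_order all_algebra.
From mathcomp Require Import all_fingroup all_solvable finfield.
From mathcomp Require Import boolp classical_sets functions cardinality.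

Set Implicit Arguments.
Unset Strict Implicit.
Unset Printing Implicit Defensive.

Import GRing.Theory.
Local Open Scope ring_scope.

(** * Subgroups and quotients of prime order *)

Lemma mulrn_mod (V : zmodType) (x : V) m a b :
  x *+ m = 0 -> a = b %[mod m] -> x *+ a = x *+ b.
Proof.
move=> xm ab; suff modE k : x *+ k = x *+ (k %% m) by rewrite modE ab -modE.
by rewrite {1}(divn_eq k m) mulrnDr mulnC mulrnA xm mul0rn add0r.
Qed.

Lemma mulrn_coprime_eq0 (V : zmodType) (x : V) a b :
  coprime a b -> x *+ a = 0 -> x *+ b = 0 -> x = 0.
Proof.
move=> cop xa xb.
have -> : x = x *+ chinese a b 1 0.
  by rewrite -[LHS]mulr1n; apply: (mulrn_mod xa); rewrite chinese_modl.
have /dvdnP[k ->] : (b %| chinese a b 1 0)%N by rewrite /dvdn chinese_modr //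
  mod0n.
by rewrite mulnC mulrnA xb mul0rn.
Qed.

Lemma additive_FpM (G : zmodType) p (i : {additive 'F_p -> G}) (c k : 'F_p) :
  i (k * c) = i c *+ k.
Proof. by rewrite -{1}(natr_Zp k) mulr_natl raddfMn. Qed.

Lemma additive_Fp_inj (G : zmodType) p (i : {additive 'F_p -> G}) : i 1 != 0 ->
  injective i.
Proof.
move=> i1 a b ab; apply/eqP; rewrite -subr_eq0; apply: contraNT i1 => c0.
by rewrite -(mulVf c0) additive_FpM raddfB ab subrr mul0rn.
Qed.

Section CyclicFactors.
Variables (G : finZmodType) (p : nat).
Hypothesis p_pr : prime p.

Lemma zmod_norm (A B : {set G}) : A \subset 'N(B)%g.
Proof.
apply/cents_norm/(sub_abelian_cent2 (FinRing.zmod_abelian [set: G]%SET));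
exact: finset.subsetT.
Qed.

(** A Sylow p-subgroup has a subgroup Q of index p; the product of Q with a Hall p'-subgroup then
    has index p in G. *)
Lemma exists_subgroup_prime_index :
  (p %| #|G|)%N -> exists M : {group G}, (#|M| * p = #|G|)%N.
Proof.
move=> pG; set GG := [set: G]%G.
have cardGG : #|GG| = #|G| by rewrite cardsT.
have [P sylP] := Sylow_exists p GG.
have [H hallH] := Hall_exists p^' (abelian_sol (FinRing.zmod_abelian GG)).
have [sPG pP _] := and3P sylP; have [sHG p'H _] := and3P hallH.
have logP : (0 < logn p #|P|)%N.
  by rewrite (card_Hall sylP) logn_part cardGG logn_gt0 mem_primes p_pr pG
    andbT -cardGG cardG_gt0.
have [Q [sQP _ cardQ]] := normal_pgroup pP (normal_refl P)
  (leq_pred (logn p #|P|)).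
have nQH := zmod_norm Q H.
have cardP : #|P| = (#|Q| * p)%N.
  by rewrite cardQ -expnSr prednK // -card_pgroup.
exists (Q <*> H)%G; rewrite /= norm_joinEl // coprime_cardMg; last first.
  exact: pnat_coprime (pgroupS sQP pP) p'H.
by rewrite mulnAC -cardP (card_Hall sylP) (card_Hall hallH)
  partnC cardGG // -cardGG.
Qed.

Lemma Fp_quotient (M : {group G}) (g : G) :
  (#|M| * p = #|G|)%N -> g \notin M ->
  exists2 h : {additive G -> 'F_p}, forall x, (h x == 0) = (x \in M) & h g = 1.
Proof.
move=> cardM gM.
have nM := zmod_norm [set: G]%SET M.
have cardQ : #|([set: G]%SET / M)%g| = p.
  by rewrite card_quotient // -divgS ?finset.subsetT //= cardsT -cardM mulKn
    ?cardG_gt0.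
have cQ : cyclic ([set: G]%SET / M)%g by apply: prime_cyclic; rewrite cardQ.
(* The carrier of ['F_p] is that of the integers modulo [pdiv p], so an isomorphism onto
   [Zp (pdiv p)] takes values in ['F_p]. *)
have : ([set: G]%SET / M)%g \isog Zp (pdiv p).
  have cardZ : #|Zp (pdiv p)| = p by rewrite card_Zp ?pdiv_gt0 // pdiv_id.
  rewrite isog_cyclic_card // cardQ cardZ eqxx andbT.
  by apply: prime_cyclic; rewrite cardZ.
case/isogP => f injf _.
have inN x : x \in 'N(M)%g := fintype.subsetP nM x (finset.in_setT x).
have inQ x : coset M x \in ([set: G]%SET / M)%g by rewrite mem_quotient ?inE.
pose h0 (x : G) : 'F_p := f (coset M x).
have h0D : {morph h0 : x y / x + y}.
  move=> x y; rewrite /h0 -FinRing.zmodMgE (morphM (coset M)) ?inN //.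
  by rewrite (morphM f) ?inQ.
have h0E x : (h0 x == 0) = (x \in M).
  rewrite -[LHS]/(f (coset M x) == 1%g) morph_injm_eq1 //.
  by apply/eqP/idP => [/coset_idr -> // | /coset_id].
pose h1 x := h0 x / h0 g.
have h1B : zmod_morphism h1.
  move=> x y; apply: (addIr (h1 y)); rewrite -mulrDl -h0D.
  by rewrite !subrK.
pose hM := GRing.isZmodMorphism.Build G 'F_p h1 h1B.
pose h : {additive G -> 'F_p} := HB.pack h1 hM.
have hg0 : h0 g != 0 by rewrite h0E.
exists h => [x|]; last by rewrite /= /h1 divff.
by rewrite /= /h1 mulf_eq0 invr_eq0 (negbTE hg0) orbF h0E.
Qed.

Lemma Fp_embedding (x : G) :
  x != 0 -> x *+ p = 0 ->
  exists i : {additive 'F_p -> G}, forall c, i c = x *+ c.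
Proof.
move=> x0 xp0.
have modE k : x *+ (k %% (Zp_trunc (pdiv p)).+2) = x *+ k.
  by apply: (mulrn_mod xp0); rewrite Fp_cast // modn_mod.
pose i0 (c : 'F_p) := x *+ c.
have i0D : {morph i0 : a b / a + b}.
  by move=> a b; rewrite /i0 /= modE mulrnDr.
have i0B : zmod_morphism i0.
  by move=> a b; apply: (addIr (i0 b)); rewrite -i0D !subrK.
pose iM := GRing.isZmodMorphism.Build 'F_p G i0 i0B.
pose i : {additive 'F_p -> G} := HB.pack i0 iM.
by exists i.
Qed.

Lemma exists_order_p (M : {group G}) :
  (p %| #|M|)%N -> exists2 x, x \in M & x != 0 /\ x *+ p = 0.
Proof.
move=> pM; have [x xM ox] := Cauchy p_pr pM; exists x => //; split.
  by apply/eqP => x0; move: ox p_pr; rewrite x0 order1 => <-.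
by rewrite -FinRing.zmodXgE -ox expg_order.
Qed.

Lemma mulrn_mem (M : {group G}) (x : G) k : x \in M -> x *+ k \in M.
Proof. by move=> xM; rewrite -FinRing.zmodXgE groupX. Qed.

Lemma mulrn_card (M : {group G}) (x : G) : x \in M -> x *+ #|M| = 0.
Proof. by move=> xM; rewrite -FinRing.zmodXgE expg_cardG. Qed.

(** G is the direct sum of [i 'F_p] and ker h, of coprime orders p and m. With e congruent to 1
    modulo p and to 0 modulo m, the projection onto [i 'F_p] is multiplication by e, hence a term
    operation. *)
Lemma squarefree_Fp_factor :
  squarefree #|G| -> (p %| #|G|)%N ->
  exists (h : {additive G -> 'F_p}) (i : {additive 'F_p -> G}) (m e : nat),
    [/\ (m * p = #|G|)%N, cancel i h, forall x, h x = 0 -> x *+ m = 0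
      & forall x, i (h x) = x *+ e].
Proof.
move=> sqf pG; have [M cardM] := exists_subgroup_prime_index pG.
have pG1 : (p %| #|[set: G]%SET|)%N by rewrite cardsT.
have pM : ~~ (p %| #|M|)%N.
  apply/negP => pM; have p1 : p = 1%N; last by have := p_pr; rewrite p1.
  by apply: sqf; rewrite -cardM expnS expn1 dvdn_mul.
have [x _ [x0 xp]] := @exists_order_p [set: G]%G pG1.
have [i iE] := Fp_embedding x0 xp.
have copM : coprime p #|M| by rewrite prime_coprime.
have xM : x \notin M.
  apply/negP => /mulrn_card xM; case/eqP: x0.
  exact: mulrn_coprime_eq0 copM xp xM.
have [h hE hx] := Fp_quotient cardM xM.
have ik : cancel i h by move=> c; rewrite iE raddfMn hx natr_Zp.
pose e := chinese p #|M| 1 0.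
exists h, i, #|M|, e; split => // [y /eqP|y].
  by rewrite hE => /mulrn_card.
have e0 : (#|M| %| e)%N by rewrite /dvdn chinese_modr // mod0n.
have e1 : (e = 1 %[mod p])%N by rewrite chinese_modl.
have ie c : i c *+ e = i c.
  by rewrite -raddfMn -mulr_natr -(Fp_nat_mod p_pr) e1 Fp_nat_mod // mulr1.
apply/eqP; rewrite eq_sym -subr_eq0 -{1}(ie (h y)) -mulrnBl.
case/dvdnP: e0 => k ->; rewrite mulnC mulrnA mulrn_card ?mul0rn //.
by rewrite -hE raddfB ik subrr.
Qed.
End CyclicFactors.

(** * Expansions and clones *)

Section TermClones.
Variable T : Type.
Implicit Types (A X : algebra T) (C : opfam T).

Lemma term_clone_is_clone A : is_clone (term_clone A).
Proof.
split=> [n i|m n f g [t <-] Cg]; first by exists (Var i).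
have {Cg} [s sE] := choice Cg.
have -> : g = fun i => term_op (s i) by apply: funext => i; rewrite sE.
elim: t => [i|a args IH]; first by exists (s i).
have {IH} [r rE] := choice IH; exists (App a r) => /=.
by congr compose; apply: funext => j; rewrite rE.
Qed.

Lemma term_clone_sub A C :
  is_clone C ->
  (forall (s : symbol A) n (g : 'I_(arity s) -> op T n.+1),
     (forall i, C n (g i)) -> C n (compose (interp A s) g)) ->
  opfam_sub (term_clone A) C.
Proof.
move=> [Cproj _] Cop n _ [t <-].
by elim: t => [i|s args IH] /=; [apply: Cproj | apply: Cop].
Qed.

Lemma interp_term_clone A (s : symbol A) n (g : 'I_(arity s) -> op T n.+1) :
  (forall i, term_clone A (g i)) -> term_clone A (compose (interp A s) g).
Proof.
move=> Cg; have [r rE] := choice Cg; exists (App s r) => /=.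
by congr compose; apply: funext => j; rewrite rE.
Qed.

Lemma opfam_sub_anti C D : opfam_sub C D -> opfam_sub D C -> C = D.
Proof.
move=> CD DC; apply: functional_extensionality_dep => n.
by apply/seteqP; split; [apply: CD | apply: DC].
Qed.

Lemma expand_clones_above A X :
  clones_above (term_clone A) (term_clone (expand A X)).
Proof.
split; first exact: term_clone_is_clone.
apply: term_clone_sub; first exact: term_clone_is_clone.
by move=> s n g Cg; apply: (@interp_term_clone (expand A X) (inl s)).
Qed.

Definition clone_algebra C : algebra T :=
  {| symbol := {nf : {n & op T n.+1} | C (tag nf) (tagged nf)};
     arity := fun s => (tag (sval s)).+1;
     interp := fun s => tagged (sval s) |}.

Lemma expand_clone_algebra A C :
  clones_above (term_clone A) C -> term_clone (expand A (clone_algebra C)) = C.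
Proof.
move=> [cC AC]; apply: opfam_sub_anti; last first.
  move=> n f Cf.
  exists (@App _ (expand A (clone_algebra C)) _
    (inr (exist (fun nf => C (tag nf) (tagged nf)) (Tagged (fun n => op T n.+1)
      f) Cf)) (fun i => Var i)).
  exact: funext.
apply: term_clone_sub => // -[s|[[m f] /= Cf]] n g Cg; last exact: cC.2.
(* Clones compose only operations of positive arity. A nullary symbol is handled through the
   constant operation that it contributes to [term_clone A]. *)
have [m0|m0] := posnP (arity s).
  have g0 (h : 'I_(arity s) -> op T n.+1) : h = g.
    by apply: funext => -[i i_lt]; exfalso; rewrite m0 in i_lt.
  by apply: AC; rewrite -(g0 (fun i => proj ord0));
    apply: interp_term_clone => i; exists (Var ord0).
have arE : arity s = (arity s).-1.+1 by rewrite prednK.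
have : forall k (e : arity s = k.+1), C n (compose (interp A s) g).
  move=> k e.
  pose f : op T k.+1 := compose (interp A s) (fun i => proj (cast_ord e i)).
  have Cf : C k f by apply: AC; apply: interp_term_clone => i;
    exists (Var (cast_ord e i)).
  have := cC.2 _ _ f (fun j => g (cast_ord (esym e) j)) Cf (fun j => Cg _).
  congr (C n _); apply: funext => x; rewrite /compose /f /compose /proj.
  by congr (interp A s); apply: funext => i; rewrite cast_ordK.
by move/(_ _ arE).
Qed.

(** Expansions up to term equivalence correspond to clones above [term_clone A]: each such clone is
    the term clone of the expansion by all of its own operations. *)
Lemma finitely_many_expansionsP A :
  finitely_many_expansions A <-> finite_set (clones_above (term_clone A)).
Proof.
split=> [[k [F F_all]]|/finite_setP[k]].
  apply: (@sub_finite_set _ _ (range (fun i : 'I_k => term_clone (expand A (F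
    i))))).
    move=> C aC; have [i ei] := F_all (clone_algebra C).
    by exists i => //; rewrite -ei expand_clone_algebra.
  by apply: finite_image; apply: finite_finset.
rewrite card_eq_sym => /card_set_bijP[f [fun_f _ surj_f]].
exists k, (fun i => clone_algebra (f i)) => X.
have [i /= ik fi] := surj_f _ (expand_clones_above A X).
exists (Ordinal ik); rewrite /term_equiv expand_clone_algebra /= fi //.
exact: expand_clones_above.
Qed.
End TermClones.

(** * Groups of non-squarefree order *)

(** Integer linear combinations of variables. The index type is arbitrary because variables indexed
    by [nat] occur later. *)
Inductive lincomb (G : zmodType) (I : Type) : ((I -> G) -> G) -> Prop :=
| lincomb_proj i : lincomb (fun x => x i)
| lincomb0 : lincomb (fun _ => 0)
| lincombD f g : lincomb f -> lincomb g -> lincomb (fun x => f x + g x)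
| lincombN f : lincomb f -> lincomb (fun x => - f x).

Section Lincomb.
Variables (G : zmodType) (I J : Type).

Lemma lincombMn (f : (I -> G) -> G) k : lincomb f ->
  lincomb (fun x => f x *+ k).
Proof.
move=> lf; elim: k => [|k IH]; first exact: lincomb0.
by rewrite (_ : (fun x => _) = fun x => f x *+ k + f x);
  [apply: lincombD | apply: funext => x; rewrite mulrSr].
Qed.

Lemma lincomb_comp (f : (I -> G) -> G) (g : I -> (J -> G) -> G) :
  lincomb f -> (forall i, lincomb (g i)) ->
    lincomb (fun x => f (fun i => g i x)).
Proof.
move=> lf lg; elim: lf => {f} [i||f h _ IHf _ IHh|f _ IHf]; first exact: lg.
- exact: lincomb0.
- exact: lincombD.
- exact: lincombN.
Qed.

Lemma lincomb_add (f : (I -> G) -> G) x y :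
  lincomb f -> f (fun i => x i + y i) = f x + f y.
Proof.
elim=> {f} [i||f g _ -> _ ->|f _ ->] //; first by rewrite addr0.
  by rewrite addrACA.
by rewrite opprD.
Qed.

Lemma lincomb_at0 (f : (I -> G) -> G) : lincomb f -> f (fun=> 0) = 0.
Proof.
by elim=> {f} [i||f g _ -> _ ->|f _ ->] //; rewrite ?addr0 ?oppr0.
Qed.

Lemma lincomb_hom (H : zmodType) (h : {additive G -> H}) (f : (I -> G) ->
  G) x y :
  lincomb f -> (forall i, h (x i) = h (y i)) -> h (f x) = h (f y).
Proof.
move=> lf xy; elim: lf => {f} [i||f g _ IHf _ IHg|f _ IHf] //.
  by rewrite !raddfD IHf IHg.
by rewrite !raddfN IHf.
Qed.

Lemma lincomb_endo (h : {additive G -> G}) (f : (I -> G) -> G) x :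
  lincomb f -> h (f x) = f (fun i => h (x i)).
Proof.
elim=> {f} [i||f g _ IHf _ IHg|f _ IHf] //; first by rewrite raddf0.
  by rewrite raddfD IHf IHg.
by rewrite raddfN IHf.
Qed.
End Lincomb.

(** * Degree of a function by finite differences *)

Section FiniteDifferences.
Variables (G V : zmodType).

(** Frechet's notion of degree: all iterated differences of order k + 1 vanish. *)
Fixpoint diff_degree_le (k : nat) (I : Type) (f : (I -> G) -> V) : Prop :=
  match k with
  | 0 => forall x y, f x = f y
  | k'.+1 => forall d, diff_degree_le k' (fun x => f (fun i => x i + d i) - f x)
  end.

Lemma diff_degree_leS k I (f : (I -> G) -> V) :
  diff_degree_le k f -> diff_degree_le k.+1 f.
Proof.
elim: k f => [|k IH] f fk d /=; last by apply: IH; apply: fk.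
by move=> x y; rewrite !(fk _ (fun=> 0)).
Qed.

Lemma diff_degree_le_trans k l I (f : (I -> G) -> V) :
  (k <= l)%N -> diff_degree_le k f -> diff_degree_le l f.
Proof.
elim: l => [|l IH]; first by rewrite leqn0 => /eqP ->.
by rewrite leq_eqVlt => /predU1P[-> //|/IH fl /fl]; apply: diff_degree_leS.
Qed.

Lemma diff_degree_leD k I (f g : (I -> G) -> V) :
  diff_degree_le k f -> diff_degree_le k g ->
    diff_degree_le k (fun x => f x + g x).
Proof.
elim: k f g => [|k IH] f g fk gk; first by move=> x y;
  rewrite (fk x y) (gk x y).
move=> d; have := IH _ _ (fk d) (gk d); congr diff_degree_le.
by apply: funext => x; rewrite opprD addrACA.
Qed.

Lemma diff_degree_leN k I (f : (I -> G) -> V) :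
  diff_degree_le k f -> diff_degree_le k (fun x => - f x).
Proof.
elim: k f => [|k IH] f fk; first by move=> x y; rewrite (fk x y).
move=> d; have := IH _ (fk d); congr diff_degree_le.
by apply: funext => x; rewrite opprB opprK addrC.
Qed.

Lemma diff_degree_le_comp k I J (f : (I -> G) -> V) (l : (J -> G) -> (I -> G)) :
  (forall x y, l (fun j => x j + y j) = fun i => l x i + l y i) ->
  diff_degree_le k f -> diff_degree_le k (fun x => f (l x)).
Proof.
move=> lD; elim: k f => [|k IH] f fk; first by move=> x y; apply: fk.
move=> d; have := IH _ (fk (l d)); congr diff_degree_le.
by apply: funext => x; rewrite lD.
Qed.
End FiniteDifferences.

Lemma diff_degree_le_inj (G V W : zmodType) (i : {additive V ->
  W}) k I (f : (I -> G) -> V) :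
  injective i -> diff_degree_le k (fun x => i (f x)) <-> diff_degree_le k f.
Proof.
move=> inj_i; elim: k f => [|k IH] f.
  by split=> fk x y; [apply: inj_i; apply: fk | rewrite (fk x y)].
have iB d : (fun x => i (f (fun j => x j + d j) - f x)) =
            (fun x => i (f (fun j => x j + d j)) - i (f x)).
  by apply: funext => x; rewrite raddfB.
by split=> fk d; [apply/IH; rewrite iB; apply: fk | rewrite -iB; apply/IH;
  apply: fk].
Qed.

Lemma lincomb_diff_degree (G : zmodType) I (f : (I -> G) -> G) :
  lincomb f -> diff_degree_le 1 f.
Proof.
move=> lf d x y; rewrite !(lincomb_add _ _ lf).
by rewrite addrAC subrr [RHS]addrAC subrr.
Qed.

Section ProductDegree.
Variables (G : zmodType) (F : fieldType) (h : {additive G -> F}) (I : eqType).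

(** Leibniz rule: as h is additive, the difference of h f in direction d is h Df + h(d) (Df + f),
    where Df is the difference of f. *)
Lemma diff_degree_leM k i (f : (I -> G) -> F) :
  diff_degree_le k f -> diff_degree_le k.+1 (fun x => h (x i) * f x).
Proof.
elim: k f => [|k IH] f fk d.
  have fE z : h (z i + d i) * f (fun j => z j + d j) - h (z i) * f z =
      h (d i) * f (fun=> 0).
    by rewrite !(fk _ (fun=> 0)) raddfD -mulrBl addrAC subrr add0r.
  by move=> x y; rewrite !fE.
have scale c l (g : (I -> G) -> F) :
    diff_degree_le l g -> diff_degree_le l (fun x => c * g x).
  elim: l g => [|l IHl] g gl; first by move=> x y; rewrite (gl x y).
  move=> e; have := IHl _ (gl e); congr diff_degree_le.
  by apply: funext => x; rewrite mulrBr.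
have := diff_degree_leD (IH _ (fk d))
  (scale (h (d i)) _ _ (diff_degree_leD (diff_degree_leS (fk d)) fk)).
congr diff_degree_le; apply: funext => x.
by rewrite subrK raddfD mulrDl mulrBr addrAC.
Qed.

Lemma diff_degree_le_prod (s : seq I) :
  diff_degree_le (size s) (fun x => \prod_(i <- s) h (x i)).
Proof.
elim: s => [|i s IH]; first by move=> x y; rewrite !big_nil.
have := diff_degree_leM i IH; congr diff_degree_le.
by apply: funext => x; rewrite big_cons.
Qed.

(** Since h g = 1, the difference in direction g of one variable deletes the factor of that variable
    and lowers the degree bound by one. *)
Lemma prod_diff_degree (g : G) (s : seq I) k :
  h g = 1 -> uniq s -> diff_degree_le k (fun x => \prod_(i <- s) h (x i)) ->
  (size s <= k)%N.
Proof.
move=> hg; elim: k s => [|k IH] [|i s] //= /andP[iNs us] sk.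
  have /eqP := sk (fun=> g) (fun=> 0).
  by rewrite big1 // big_cons raddf0 mul0r oner_eq0.
apply: IH => //; have := sk (fun j => if j == i then g else 0).
congr diff_degree_le; apply: funext => x.
rewrite !big_cons eqxx raddfD hg mulrDl mul1r addrC.
have -> : \prod_(j <- s) h (x j + (if j == i then g else 0)) = \prod_(j <- s)
  h (x j).
  apply: eq_big_seq => j js; case: eqP => [ji|]; last by rewrite addr0.
  by rewrite -ji js in iNs.
by rewrite addKr.
Qed.
End ProductDegree.

Lemma term_clone_lincomb (G : zmodType) n (f : op G n.+1) :
  term_clone (group_algebra G) f -> lincomb f.
Proof.
case=> t <-; elim: t => [i|[] args IH] /=; first exact: lincomb_proj.
- exact: lincombD.
- exact: lincombN.
- exact: lincomb0.
Qed.

(** * An infinite chain of clones of bounded degree *)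

Section NonSquarefree.
Variables (G : zmodType) (F : fieldType).
Variables (h : {additive G -> F}) (i : {additive F -> G}).

(* As e takes values in ker h and factors through h, substituting such
   operations into one another never nests two nonlinear parts, so the degree
   bound k survives composition. *)
Definition degree_clone (k : nat) : opfam G := fun n f =>
  exists (l e : op G n.+1), [/\ lincomb l, diff_degree_le k e,
    forall x, h (e x) = 0, forall x y, (forall j,
      h (x j) = h (y j)) -> e x = e y
    & forall x, f x = l x + e x].

Lemma degree_clone_mono k l : (k <= l)%N ->
  opfam_sub (degree_clone k) (degree_clone l).
Proof.
move=> kl n f [a [e [la ek he e0 fE]]]; exists a, e; split => //.
exact: diff_degree_le_trans kl ek.
Qed.

Lemma degree_clone_above k :
  clones_above (term_clone (group_algebra G)) (degree_clone k).
Proof.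
have e0 n : diff_degree_le k (fun x : 'I_n.+1 -> G => 0 : G).
  exact: (@diff_degree_le_trans _ _ 0).
split; last first.
  move=> n f /term_clone_lincomb lf; exists f, (fun _ => 0); split => //.
    by move=> x; rewrite raddf0.
  by move=> x; rewrite addr0.
split=> [n j|m n f g [l [e [ll ek he hinv fE]]] Cg].
  exists (proj j), (fun _ => 0); split => //; first exact: lincomb_proj.
    by move=> x; rewrite raddf0.
  by move=> x; rewrite addr0.
have {Cg} [l' Cg] := choice Cg; have {Cg} [e' Cg] := choice Cg.
have lA j : lincomb (l' j) by have [] := Cg j.
exists (fun x => l (fun j => l' j x)).
(* The outer [e] sees its arguments only through h, which kills the inner parts [e']; so [e] is
   evaluated at the linear parts alone. *)
exists (fun x => l (fun j => e' j x) + e (fun j => l' j x)); split.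
- exact: lincomb_comp.
- apply: diff_degree_leD.
    elim: ll => [j||a b _ IHa _ IHb|a _ IHa] //; first by have [] := Cg j.
      exact: diff_degree_leD.
    exact: diff_degree_leN.
  apply: (@diff_degree_le_comp G G k _ _ e (fun x j => l' j x)) => // x y.
  by apply: funext => j; rewrite lincomb_add.
- move=> x; rewrite raddfD he addr0.
  rewrite (@lincomb_hom _ _ _ h l _ (fun=> 0) ll) => [|j].
    by rewrite lincomb_at0 // raddf0.
  by have [_ _ -> _ _] := Cg j; rewrite raddf0.
- move=> x y xy; congr (_ + _).
    by congr l; apply: funext => j; have [_ _ _ ej _] := Cg j; apply: ej.
  by apply: hinv => j; apply: lincomb_hom.
- move=> x; rewrite /compose fE addrA -lincomb_add //; congr (l _ + _).
    by apply: funext => j; have [] := Cg j.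
  apply: hinv => j; have [_ _ h0 _ ->] := Cg j.
  by rewrite raddfD h0 addr0.
Qed.

Lemma infinite_clones_above (g : G) :
  h g = 1 -> injective i -> (forall c, h (i c) = 0) ->
  ~ finite_set (clones_above (term_clone (group_algebra G))).
Proof.
move=> hg inj_i hi fin.
(* The separating operation is a product of k + 2 factors. The smaller bound k + 1 is at least 1, so
   it also absorbs the linear part [l]. *)
have sep k : ~ opfam_sub (degree_clone k.+2) (degree_clone k.+1).
  pose f (x : 'I_k.+2 -> G) := i (\prod_(j <- enum 'I_k.+2) h (x j)).
  have sz : size (enum 'I_k.+2) = k.+2 by rewrite size_enum_ord.
  move=> /(_ _ f)[].
    exists (fun _ => 0), f; split; first exact: lincomb0.
    - by apply/diff_degree_le_inj => //;
      have := diff_degree_le_prod h (enum 'I_k.+2); rewrite sz.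
    - by move=> x; rewrite hi.
    - by move=> x y xy; congr (i _); apply: eq_bigr => j _.
    - by move=> x; rewrite add0r.
  move=> l [e [ll ek _ _ fE]].
  have : diff_degree_le k.+1 f.
    have -> : f = fun x => l x + e x by apply: funext.
    apply: diff_degree_leD => //; apply: (@diff_degree_le_trans _ _ 1) => //.
    exact: lincomb_diff_degree.
  move/(diff_degree_le_inj _ _ inj_i)/(prod_diff_degree hg (enum_uniq _)).
  by rewrite sz ltnn.
have inj_D : injective (fun k => degree_clone k.+1).
  move=> k l; wlog kl : k l / (k < l)%N => [W kl|].
    by case: (ltngtP k l) => // lt; [apply: W | apply/esym; apply: W].
  move=> kl_eq; exfalso; case: l kl kl_eq => // l kl kl_eq; apply: (sep l).
  by rewrite -kl_eq; apply: degree_clone_mono.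
apply: infinite_nat.
have -> : [set: nat]%classic = ((fun k => degree_clone k.+1) @^-1`
    clones_above (term_clone (group_algebra G)))%classic.
  by apply/seteqP; split=> k _ //; apply: degree_clone_above.
by apply: finite_preimage fin => x y _ _; apply: inj_D.
Qed.
End NonSquarefree.

Lemma infinite_not_squarefree (G : finZmodType) :
  finite_set (clones_above (term_clone (group_algebra G))) -> squarefree #|G|.
Proof.
move=> fin d d2; apply/eqP; apply: contraPT fin => d1.
have G0 : (0 < #|G|)%N by apply/card_gt0P; exists 0.
have d0 : (0 < d)%N by case: d d2 {d1} => //; rewrite exp0n // dvd0n;
  case: #|G| G0.
have [p p_pr pd] : exists2 p, prime p & (p %| d)%N.
  by exists (pdiv d); rewrite ?pdiv_dvd // pdiv_prime // ltn_neqAle eq_sym d1.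
have p2 : (p * p %| #|G|)%N.
  by apply: dvdn_trans d2; rewrite expnS expn1 dvdn_mul.
have [M cM] := exists_subgroup_prime_index p_pr (dvdn_trans (dvdn_mulr p (dvdnn
  p)) p2).
(* As p^2 divides |G|, the kernel M of the map to ['F_p] still contains an element of order p. *)
have pM : (p %| #|M|)%N by rewrite -(@dvdn_pmul2r p) ?prime_gt0 // cM.
have [x xM [x0 xp]] := exists_order_p p_pr pM.
have [i iE] := Fp_embedding p_pr x0 xp.
have [g gM] : exists g, g \notin M.
  apply/existsP; rewrite -negb_forall; apply/negP => /forallP allM.
  have: (#|M| < #|G|)%N by rewrite -cM ltn_Pmulr ?prime_gt1 ?cardG_gt0.
  rewrite ltnNge; case/negP; apply: subset_leq_card.
  by apply/fintype.subsetP => y _.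
have [h hE hg] := Fp_quotient p_pr cM gM.
apply: (@infinite_clones_above G 'F_p h i g hg) => [|c]; last first.
  by apply/eqP; rewrite hE iE mulrn_mem.
by apply: additive_Fp_inj; rewrite iE.
Qed.

(** * Reduction of two variables to one *)

Section PlaneLines.
Variables (F : finFieldType) (V : zmodType) (f : F -> F -> V).

(** The lines through (x, y), one for each slope parameter t and one with constant second
    coordinate, cover (x, y) itself #|F| + 1 times and every other point once. *)
Lemma sum_lines_through x y :
  \sum_t \sum_w f (x + t * y - t * w) w + \sum_u f u y =
  f x y *+ #|F| + \sum_w \sum_u f u w.
Proof.
rewrite exchange_big /= (bigD1 y) //= [in RHS](bigD1 y) //=.
have -> : \sum_t f (x + t * y - t * y) y = f x y *+ #|F|.
  by under eq_bigr do rewrite addrK; rewrite sumr_const cardT -cardE.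
rewrite -!addrA; congr (_ + _); rewrite addrC; congr (_ + _).
apply: eq_bigr => w wy; have yw : y - w != 0 by rewrite subr_eq0 eq_sym.
rewrite [RHS](reindex (fun t => x + t * y - t * w)) //=.
exists (fun u => (u - x) / (y - w)) => u _ /=.
  by rewrite -(addrA x) -mulrBr addrAC subrr add0r mulfK.
by rewrite -(addrA x) -mulrBr mulfVK // addrC subrK.
Qed.

(* The sum of f over the line u + t w = x + t y only involves values of f at
   multiples of the single element x + t y. Summing over all lines through
   (x, y) and subtracting the lines through the origin leaves
   f x y - f 0 0 taken #|F| times. *)
Lemma rank_one_plane x y :
  \sum_t \sum_s (f ((1 - t * s) * (x + t * y)) (s * (x + t * y))
                 - f (- (t * s) * (x + t * y)) (s * (x + t * y))) +
  \sum_s (f (s * y) y - f (s * y) 0) = (f x y - f 0 0) *+ #|F|.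
Proof.
(* For z != 0 the multiples s z run through F; for z = 0 both sides vanish because g and g' agree
   there. *)
have scale (g g' : F -> F -> V) (z : F) : (forall w, z = 0 -> g z w = g' z w) ->
    \sum_s (g z (s * z) - g' z (s * z)) = \sum_w g z w - \sum_w g' z w.
  have [-> gg'|z0 _] := eqVneq z 0.
    by rewrite -!sumrB; apply: eq_big => // s _; rewrite !gg' ?subrr.
  rewrite -sumrB [RHS](reindex (fun s => s * z)) //=.
  by exists (fun s => s / z) => s _; rewrite ?mulfK ?mulfVK.
have -> : \sum_s (f (s * y) y - f (s * y) 0) = \sum_u f u y - \sum_u f u 0.
  by rewrite (scale (fun z w => f w z) (fun _ w => f w 0)) // => w ->.
have lineE t : \sum_s (f ((1 - t * s) * (x + t * y)) (s * (x + t * y))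
                 - f (- (t * s) * (x + t * y)) (s * (x + t * y))) =
    \sum_w f (x + t * y - t * w) w - \sum_w f (0 + t * 0 - t * w) w.
  rewrite -(scale (fun z w => f (z - t * w) w) (fun _ w => f (0 + t * 0 - t * w)
    w)).
    by apply: eq_bigr => s _; rewrite mulr0 add0r add0r mulrBl mul1r mulNr
      mulrA.
  by move=> w ->; rewrite mulr0 addr0.
under eq_bigr do rewrite lineE.
rewrite sumrB addrACA -opprD !sum_lines_through.
by rewrite opprD addrACA subrr addr0 mulrnBl.
Qed.
End PlaneLines.

Section RankOne.
Variables (G : zmodType) (F : fieldType).

(* A 2 x 2 integer matrix A acts on functions of two variables by r |-> r \o A.
   These are the operators that agree, on m-torsion, with an F-linear
   combination of matrices of the form a b^T. If the identity is one of them,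
   functions of two variables are generated by functions of one variable. *)
Inductive rank_one (m : nat) : ((G -> G -> F) -> G -> G -> F) -> Prop :=
| rank_one_basic a1 a2 b1 b2 : rank_one m (fun r x y =>
    r ((x *+ b1 + y *+ b2) *+ a1) ((x *+ b1 + y *+ b2) *+ a2))
| rank_oneD P Q : rank_one m P -> rank_one m Q ->
    rank_one m (fun r x y => P r x y + Q r x y)
| rank_oneZ c P : rank_one m P -> rank_one m (fun r x y => c * P r x y)
| rank_one_ext P Q :
    (forall r x y, x *+ m = 0 -> y *+ m = 0 -> P r x y = Q r x y) ->
    rank_one m P -> rank_one m Q.

Lemma rank_one0 m : rank_one m (fun _ _ _ => 0).
Proof.
apply: rank_one_ext (rank_oneZ 0 (rank_one_basic m 0 0 0 0)) => r x y _ _.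
by rewrite mul0r.
Qed.

Lemma rank_oneB m P Q :
  rank_one m P -> rank_one m Q -> rank_one m (fun r x y => P r x y - Q r x y).
Proof.
move=> rP rQ; apply: rank_one_ext (rank_oneD rP (rank_oneZ (-1) rQ))
  => r x y _ _.
by rewrite mulN1r.
Qed.

Lemma rank_one_sum m (I : finType) (P : I -> (G -> G -> F) -> G -> G -> F) :
  (forall i, rank_one m (P i)) -> rank_one m (fun r x y => \sum_i P i r x y).
Proof.
move=> rP; elim: (index_enum I) => [|i s IH].
  by apply: rank_one_ext (rank_one0 m) => r x y _ _; rewrite big_nil.
by apply: rank_one_ext (rank_oneD (rP i) IH) => r x y _ _; rewrite big_cons.
Qed.

(** The identity [rank_one_plane], divided by q, expresses r x y - r 0 0 by rank-one terms; r 0 0 is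
    the basic operator with zero coefficients. *)
Lemma rank_one_prime q (i : {additive 'F_q -> G}) :
  prime q -> q%:R != 0 :> F ->
  (forall x, x *+ q = 0 -> exists c, x = i c) -> rank_one q (fun r => r).
Proof.
move=> q_pr q0 i_surj.
pose P (a1 a2 b1 b2 : 'F_q) (r : G -> G -> F) x y :=
  r ((x *+ b1 + y *+ b2) *+ a1) ((x *+ b1 + y *+ b2) *+ a2).
have rP a1 a2 b1 b2 : rank_one q (P a1 a2 b1 b2) by apply: rank_one_basic.
have := rank_oneD (rP 0 0 0 0) (rank_oneZ (q%:R^-1) (rank_oneD
  (rank_one_sum (fun t => rank_one_sum (fun s =>
     rank_oneB (rP (1 - t * s) s 1 t) (rP (- (t * s)) s 1 t))))
  (rank_one_sum (fun s => rank_oneB (rP s 1 0 1) (rP s 0 0 1))))).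
apply: rank_one_ext => r _ _ /i_surj[x ->] /i_surj[y ->].
pose f a b := r (i a) (i b).
have PE a1 a2 b1 b2 : P a1 a2 b1 b2 r (i x) (i y) =
    f (a1 * (b1 * x + b2 * y)) (a2 * (b1 * x + b2 * y)).
  by rewrite /P /f !additive_FpM raddfD !additive_FpM.
rewrite PE !mul0r -[r (i x) (i y)]/(f x y).
have -> : \sum_t \sum_s (P (1 - t * s) s 1 t r (i x) (i y) -
                         P (- (t * s)) s 1 t r (i x) (i y)) =
    \sum_t \sum_s (f ((1 - t * s) * (x + t * y)) (s * (x + t * y))
                 - f (- (t * s) * (x + t * y)) (s * (x + t * y))).
  by apply: eq_bigr => t _; apply: eq_bigr => s _; rewrite !PE mul1r.
have -> : \sum_s (P s 1 0 1 r (i x) (i y) - P s 0 0 1 r (i x) (i y)) =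
    \sum_s (f (s * y) y - f (s * y) 0).
  by apply: eq_bigr => s _; rewrite !PE !mul0r !mul1r add0r.
rewrite rank_one_plane card_Fp // -[(_ - _) *+ q]mulr_natl mulKf //.
by rewrite addrC subrK.
Qed.

(** An element of mn-torsion splits into parts of m-torsion and n-torsion. [comb] lets P act on the
    first parts and Q on the second, and two basic operators combine to a basic one by the Chinese
    remainder theorem. *)
Lemma rank_oneM m n :
  coprime m n -> rank_one m (fun r => r) -> rank_one n (fun r => r) ->
  rank_one (m * n) (fun r => r).
Proof.
move=> cop rm rn.
have modE a b (x : G) : x *+ (m * n) = 0 -> a = b %[mod m] -> a = b %[mod n] ->
  x *+ a = x *+ b.
  move=> x0 am an; apply: (mulrn_mod x0); apply/eqP.
  by rewrite chinese_remainder // am an !eqxx.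
have [e [em en]] : exists e, e = 1 %[mod m] /\ e = 0 %[mod n].
  by exists (chinese m n 1 0); rewrite chinese_modl // chinese_modr.
have [e' [em' en']] : exists e, e = 0 %[mod m] /\ e = 1 %[mod n].
  by exists (chinese m n 0 1); rewrite chinese_modl // chinese_modr.
have split_id (x : G) : x *+ (m * n) = 0 -> x *+ e + x *+ e' = x.
  move=> x0; rewrite -mulrnDr -[RHS]mulr1n; apply: modE => //.
    by rewrite -modnDm em em' modnDm.
  by rewrite -modnDm en en' modnDm.
have tors_e (x : G) : x *+ (m * n) = 0 -> x *+ e *+ m = 0.
  move=> x0; rewrite -mulrnA -[RHS](mulr0n x); apply: modE => //.
    by rewrite modnMl mod0n.
  by rewrite -modnMm en modnMm mul0n.
have tors_e' (x : G) : x *+ (m * n) = 0 -> x *+ e' *+ n = 0.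
  move=> x0; rewrite -mulrnA -[RHS](mulr0n x); apply: modE => //.
    by rewrite -modnMm em' modnMm mul0n.
  by rewrite modnMl mod0n.
pose comb (P Q : (G -> G -> F) -> G -> G -> F) (r : G -> G -> F) x y :=
  P (fun s t =>
  Q (fun s' t' => r (s + s') (t + t')) (x *+ e') (y *+ e')) (x *+ e) (y *+ e).
suff comb_rank P Q : rank_one m P -> rank_one n Q ->
  rank_one (m * n) (comb P Q).
  apply: rank_one_ext (comb_rank _ _ rm rn) => r x y x0 y0.
  by rewrite /comb !split_id.
move=> {rm} rP {rn} rQ.
elim: rP => {P} [a1 a2 b1 b2|P P' _ IH _ IH'|c P _ IH|P P' PP' _ IH].
- elim: rQ => {Q} [a1' a2' b1' b2'|Q Q' _ IH _ IH'|c Q _ IH|Q Q' QQ' _ IH].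
  + apply: rank_one_ext (rank_one_basic (m * n) (a1 * e + a1' * e')
    (a2 * e + a2' * e')
      (b1 * e + b1' * e') (b2 * e + b2' * e')) => r x y x0 y0; rewrite /comb.
    pose u := x *+ b1 + y *+ b2; pose u' := x *+ b1' + y *+ b2'.
    have u0 : u *+ (m * n) = 0 by rewrite mulrnDl !(mulrnAC _ _ (m * n))
      x0 y0 !mul0rn addr0.
    have u0' : u' *+ (m * n) = 0 by rewrite mulrnDl !(mulrnAC _ _ (m * n))
      x0 y0 !mul0rn addr0.
    have uE c c' : (x *+ (b1 * e + b1' * e') + y *+ (b2 * e + b2' * e'))
      *+ (c * e + c' * e') =
        (x *+ e *+ b1 + y *+ e *+ b2) *+ c + (x *+ e' *+ b1' + y *+ e' *+ b2')
          *+ c'.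
      have -> : x *+ (b1 * e + b1' * e') + y *+ (b2 * e + b2' * e')
        = u *+ e + u' *+ e'.
        by rewrite /u /u' !mulrnDr !mulrnDl !mulrnA addrACA.
      have -> : x *+ e *+ b1 + y *+ e *+ b2 = u *+ e by rewrite /u mulrnDl
        !(mulrnAC _ _ e).
      have -> : x *+ e' *+ b1' + y *+ e' *+ b2' = u' *+ e' by rewrite /u'
        mulrnDl !(mulrnAC _ _ e').
      have te := tors_e _ u0; have te' := tors_e' _ u0'.
      rewrite mulrnDl !(mulnC c) !(mulnC c') !mulrnDr !mulrnA.
      rewrite (mulrn_mod te em) (mulrn_mod te em') (mulrn_mod te' en)
        (mulrn_mod te' en').
      by rewrite !mulr0n !mul0rn addr0 add0r.
    by rewrite !uE.
  + exact: rank_oneD.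
  + exact: rank_oneZ.
  + apply: rank_one_ext IH => r x y x0 y0; apply: QQ'; exact: tors_e'.
- exact: rank_oneD.
- exact: rank_oneZ.
- apply: rank_one_ext IH => r x y x0 y0; apply: PP'; exact: tors_e.
Qed.
End RankOne.

(** One prime q is split off m at a time; since q^2 does not divide |G|, the q-torsion of G is a
    single copy of ['F_q]. *)
Lemma rank_one_squarefree (G : finZmodType) (F : fieldType) m :
  squarefree #|G| -> (m %| #|G|)%N -> m%:R != 0 :> F ->
  rank_one m (fun r : G -> G -> F => r).
Proof.
move=> sqf; have [n] := ubnP m; elim: n m => // n IH m /ltnSE mn mG mF.
have G0 : (0 < #|G|)%N by apply/card_gt0P; exists 0.
have m0 := dvdn_gt0 G0 mG.
have [m1|m1] := leqP m 1.
  have {m1}m1 : m = 1%N by apply/eqP; rewrite eqn_leq m1.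
  apply: rank_one_ext (@rank_one_basic G F m 0 0 0 0) => r x y.
  by rewrite m1 !mulr1n => -> ->; rewrite !mulr0n.
have q_pr := pdiv_prime m1; set q := pdiv m in q_pr.
have /dvdnP[k mE] : (q %| m)%N by apply: pdiv_dvd.
have qG : (q %| #|G|)%N by apply: dvdn_trans mG; apply: pdiv_dvd.
have [qF kF] : q%:R != 0 :> F /\ k%:R != 0 :> F.
  by apply/andP; move: mF; rewrite mE natrM mulf_eq0 negb_or andbC.
have cop : coprime k q.
  rewrite coprime_sym prime_coprime //; apply/negP => /dvdnP[l kE].
  have q1 : q = 1%N by apply: sqf; apply: dvdn_trans mG;
    rewrite mE kE -mulnA dvdn_mull.
  by rewrite q1 in q_pr.
have k0 : (0 < k)%N by move: m0; rewrite mE muln_gt0 => /andP[].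
rewrite mE; apply: rank_oneM => //.
  apply: IH kF; last by apply: dvdn_trans mG; rewrite mE dvdn_mulr.
  by apply: leq_trans mn; rewrite mE ltn_Pmulr ?prime_gt1.
have [h [i [l [e [lq ih hl _]]]]] := squarefree_Fp_factor q_pr sqf qG.
apply: (rank_one_prime (i := i) q_pr qF) => x xq; exists (h x); apply/eqP.
rewrite -subr_eq0; apply/eqP.
apply: (@mulrn_coprime_eq0 _ _ l q).
- rewrite coprime_sym prime_coprime //; apply/negP => /dvdnP[c lE].
  have q1 : q = 1%N by apply: sqf; rewrite -lq lE -mulnA dvdn_mull.
  by rewrite q1 in q_pr.
- by apply: hl; rewrite raddfB ih subrr.
- by rewrite mulrnBl xq -raddfMn -mulr_natr pchar_Fp_0 // mulr0 raddf0 subr0.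
Qed.

(** * Polynomial functions over finite fields *)

Section FiniteFieldSums.
Variable F : finFieldType.

Lemma finField_card_gt1 : (1 < #|F|)%N.
Proof. by rewrite (cardD1 0) (cardD1 1) !inE oner_eq0. Qed.

Lemma finField_card_eq0 : #|F|%:R = 0 :> F.
Proof.
have := @mulrn_card F [set: F]%G 1 (finset.in_setT _).
by rewrite cardsT.
Qed.

Lemma expf_card_pred (c : F) : c ^+ #|F|.-1 = (c != 0)%:R.
Proof.
have q1 := finField_card_gt1.
have [->|c0] := eqVneq c 0; first by rewrite expr0n -subn1 subn_eq0 leqNgt q1.
by apply: (mulfI c0); rewrite -exprS prednK ?(ltnW q1) // expf_card mulr1.
Qed.

Lemma sum_expf_card_pred : \sum_(c : F) c ^+ #|F|.-1 = -1.
Proof.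
have E (c : F) : c ^+ #|F|.-1 = 1 - (c == 0)%:R.
  by rewrite expf_card_pred; case: eqP; rewrite ?subrr ?subr0.
under eq_bigr do rewrite E.
rewrite sumrB sumr_const cardT -cardE finField_card_eq0 sub0r.
by rewrite (bigD1 0) //= eqxx big1 ?addr0 // => c /negbTE ->.
Qed.

(** For k > 0, X^k - 1 has too few roots to vanish on all nonzero elements, so a^k != 1 for some
    nonzero a; replacing c by a c multiplies the sum by a^k. For k = 0 the sum is #|F| = 0. *)
Lemma sum_expf k : (k < #|F|.-1)%N -> \sum_(c : F) c ^+ k = 0.
Proof.
have [-> _|k0 kq] := posnP k.
  by under eq_bigr do rewrite expr0;
    rewrite sumr_const cardT -cardE finField_card_eq0.
have [a a0 ak] : exists2 a : F, a != 0 & a ^+ k != 1.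
  apply/exists_inP; apply: contraLR kq;
    rewrite negb_exists_in => /forall_inP all1.
  rewrite -leqNgt; have -> : #|F|.-1 = size (enum [pred c : F | c != 0]).
    rewrite -cardE (cardD1 0) inE /=.
    by apply: eq_card => c; rewrite !inE andbT.
  apply: max_unity_roots (enum_uniq _) => //.
  apply/allP => c; rewrite mem_enum => /all1; rewrite negbK => /eqP ck.
  by apply/unity_rootP.
have : \sum_(c : F) c ^+ k = a ^+ k * \sum_(c : F) c ^+ k.
  rewrite mulr_sumr (reindex (fun c => a * c)) /=.
    by apply: eq_bigr => c _; rewrite exprMn.
  by exists (fun c => a^-1 * c) => c _; rewrite ?mulKf ?mulVKf.
move/eqP; rewrite -subr_eq0 -{1}[\sum_(_ : F) _]mul1r -mulrBl mulf_eq0 subr_eq0.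
by rewrite eq_sym (negbTE ak) => /eqP.
Qed.

(** The weight c^(q-2), with q = #|F|, extracts the coefficient of c in (x + c y)^(a+1): among the
    power sums that occur, only that of exponent q - 1 is nonzero. *)
Lemma polarization a (x y : F) : (a.+1 < #|F|)%N ->
  \sum_c c ^+ #|F|.-2 * (x + c * y) ^+ a.+1 = - (a.+1%:R * (x ^+ a * y)).
Proof.
move=> aq; have q1 := finField_card_gt1.
under eq_bigr do rewrite exprDn mulr_sumr.
rewrite exchange_big /= (bigD1 (Ordinal (isT : 1 < a.+2)%N))
  //= [X in _ + X]big1 ?addr0.
  have E (c : F) : c ^+ #|F|.-2 * (x ^+ (a.+1 - 1) * (c * y) ^+ 1 *+ 'C(a.+1,
    1)) =
      c ^+ #|F|.-2.+1 * (a.+1%:R * (x ^+ a * y)).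
    by rewrite subn1 expr1 bin1 -mulr_natl (mulrCA (x ^+ a)) (mulrCA _ c)
      exprS !mulrA (mulrC c).
  under eq_bigr do rewrite E.
  rewrite -mulr_suml (_ : #|F|.-2.+1 = #|F|.-1);
    last by rewrite prednK // -subn1 subn_gt0.
  by rewrite sum_expf_card_pred mulN1r.
move=> [[|[|b]] b_lt] //= _.
  under eq_bigr do rewrite subn0 bin0 mulr1n expr0 mulr1.
  rewrite -mulr_suml sum_expf ?mul0r // -subn2 -subn1 ltn_sub2l //.
have cE (c : F) : c ^+ #|F|.-2 * (x ^+ (a.+1 - b.+2) * (c * y)
  ^+ b.+2 *+ 'C(a.+1, b.+2)) =
    c ^+ b.+1 * (x ^+ (a.+1 - b.+2) * y ^+ b.+2 *+ 'C(a.+1, b.+2)).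
  rewrite exprMn !mulrnAr; congr (_ *+ _).
  rewrite (mulrCA (x ^+ _)) (mulrA (c ^+ #|F|.-2)); congr (_ * _);
    rewrite -exprD.
  have -> : (#|F|.-2 + b.+2)%N = (#|F| + b)%N by rewrite !addnS -!addSn;
    case: #|F| q1 => [|[]].
  by rewrite exprD expf_card exprS.
under eq_bigr do rewrite cE.
rewrite -mulr_suml sum_expf ?mul0r //.
by rewrite -ltnS in b_lt; rewrite -ltnS prednK ?(ltnW q1) //;
  apply: leq_trans aq; rewrite ltnS in b_lt.
Qed.

Variable g : F -> F.

(* Coefficient of x ^+ a.+1. For a.+1 = #|F|.-1 the weight of c = 0 is
   0 ^+ 0 = 1, which is harmless because g c - g 0 vanishes there. *)
Definition interp_coef (a : nat) :=
  - \sum_c c ^+ (#|F|.-1 - a.+1) * (g c - g 0).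

(** This form exhibits each monomial of g as a combination of the rescaled functions g (c x), which
    is how monomials are shown to lie in a clone. *)
Lemma interp_coefM a x : (a < #|F|.-1)%N ->
  x ^+ a.+1 * interp_coef a = - \sum_c c ^+ (#|F|.-1 - a.+1) * (g (c * x)
    - g 0).
Proof.
move=> aq; have [->|x0] := eqVneq x 0.
  rewrite expr0n mul0r big1 ?oppr0 // => c _.
  by rewrite mulr0 subrr mulr0.
rewrite /interp_coef mulrN mulr_sumr [in LHS](reindex (fun c => c * x)) /=;
  last first.
  by exists (fun c => c / x) => c _; rewrite ?mulfK ?mulfVK.
congr (- _); apply: eq_bigr => c _; rewrite mulrA exprMn; congr (_ * _).
by rewrite mulrCA -exprD subnKC // expf_card_pred x0 mulr1.
Qed.

(** The weights sum over a to a geometric series in c, which vanishes for c other than 0 and 1. The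
    term c = 0 carries g 0 - g 0, and c = 1 has weight #|F| - 1 = -1. *)
Lemma interpolation x :
  g x = g 0 + \sum_(a < #|F|.-1) x ^+ a.+1 * interp_coef a.
Proof.
have q1 := finField_card_gt1.
under eq_bigr do rewrite interp_coefM //.
rewrite sumrN exchange_big /=.
under eq_bigr do rewrite -mulr_suml.
rewrite (bigD1 1) //= [X in - (_ + X)]big1 => [|c c1].
  under eq_bigr do rewrite expr1n.
  rewrite mul1r addr0 sumr_const card_ord -subn1 natrB ?(ltnW q1)
    // finField_card_eq0.
  by rewrite sub0r mulN1r opprK addrC subrK.
have [->|c0] := eqVneq c 0; first by rewrite mul0r subrr mulr0.
suff -> : \sum_(a < #|F|.-1) c ^+ (#|F|.-1 - a.+1) = 0 by rewrite mul0r.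
rewrite (reindex_inj rev_ord_inj) /=.
have : (c - 1) * \sum_(a < #|F|.-1)
  c ^+ a = 0 by rewrite -subrX1 expf_card_pred c0 subrr.
move/eqP; rewrite mulf_eq0 subr_eq0 (negbTE c1) /= => /eqP s0; rewrite -[RHS]s0.
by apply: eq_bigr => a _; rewrite subnSK // subKn // ltnW.
Qed.
End FiniteFieldSums.

(** * Operations with values in a primary component *)

(* Membership in C for operations whose variables are indexed by an arbitrary
   type; clone_opP relates it to C itself. *)
Definition clone_op (G : Type) (C : opfam G) (I : Type) (f : (I -> G) ->
  G) : Prop :=
  forall n (s : I -> op G n.+1),
    (forall j, C n (s j)) -> C n (fun v => f (fun j => s j v)).

Section CloneOp.
Variables (G : zmodType) (C : opfam G).
Hypothesis aC : clones_above (term_clone (group_algebra G)) C.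

Lemma clone_opP n (f : op G n.+1) : C f <-> clone_op C f.
Proof.
split=> [Cf m s Cs|]; first exact: aC.1.2.
by move/(_ n (@proj G n.+1) (aC.1.1 n)).
Qed.

Lemma clone_op_proj I (j : I) : clone_op C (fun v : I -> G => v j).
Proof. by move=> n s. Qed.

Lemma clone_op_comp I J (f : (I -> G) -> G) (s : I -> (J -> G) -> G) :
  clone_op C f -> (forall j, clone_op C (s j)) ->
  clone_op C (fun v => f (fun j => s j v)).
Proof. by move=> Cf Cs n t Ct; apply: Cf => j; apply: Cs. Qed.

Lemma clone_op_interp I (a : group_symbol) (s : 'I_(group_arity a) -> (I ->
  G) -> G) :
  (forall j, clone_op C (s j)) ->
    clone_op C (fun v => group_interp (fun j => s j v)).
Proof.
move=> Cs n t Ct.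
have Cst j : C (fun v => s j (fun k => t k v)) by apply: Cs.
case: a s Cs Cst => s Cs Cst.
- have Cadd : C (fun v : 'I_2 -> G => v ord0 + v ord_max).
    by apply: aC.2; exists (@App _ (group_algebra G) _ Add (fun j => Var j)).
  exact: aC.1.2 Cadd Cst.
- have Copp : C (fun v : 'I_1 -> G => - v ord0).
    by apply: aC.2; exists (@App _ (group_algebra G) _ Opp (fun j => Var j)).
  exact: aC.1.2 Copp Cst.
- apply: aC.2; exists (@App _ (group_algebra G)
  _ Zero (fun j => Var (widen_ord (leq0n _) j))).
  by [].
Qed.

Lemma clone_op0 I : clone_op C (fun _ : I -> G => 0).
Proof.
apply: (@clone_op_interp _ Zero (fun _ _ => 0)) => -[j j_lt].
by have := j_lt; rewrite ltn0.
Qed.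

Lemma clone_opD I (f g : (I -> G) -> G) :
  clone_op C f -> clone_op C g -> clone_op C (fun v => f v + g v).
Proof.
move=> Cf Cg; apply: (@clone_op_interp _ Add (fun j => if j == ord0 then f else
  g)).
by move=> j; case: ifP.
Qed.

Lemma clone_opN I (f : (I -> G) -> G) : clone_op C f ->
  clone_op C (fun v => - f v).
Proof. by move=> Cf; apply: (@clone_op_interp _ Opp (fun _ => f)). Qed.

Lemma clone_op_lincomb I (f : (I -> G) -> G) : lincomb f -> clone_op C f.
Proof.
elim=> {f} [j||f g _ Cf _ Cg|f _ Cf].
- exact: clone_op_proj.
- exact: clone_op0.
- exact: clone_opD.
- exact: clone_opN.
Qed.

Lemma clone_opMn I (f : (I -> G) -> G) k : clone_op C f ->
  clone_op C (fun v => f v *+ k).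
Proof.
move=> Cf; have Cu : clone_op C (fun v : unit -> G => v tt *+ k).
  by apply: clone_op_lincomb; apply: lincombMn; apply: lincomb_proj.
exact: (clone_op_comp Cu (s := fun _ => f)).
Qed.
End CloneOp.

Section FpOp.
Variables (G : finZmodType) (p : nat) (h : {additive G -> 'F_p}).
Variables (i : {additive 'F_p -> G}) (e : nat).
Hypotheses (p_pr : prime p) (ih : cancel i h) (ihE : forall x,
  i (h x) = x *+ e).

Definition compl_part : {additive G -> G} := idfun \- (i \o h).

Lemma compl_partE x : compl_part x = x - i (h x).
Proof. by []. Qed.

Lemma h_compl_part x : h (compl_part x) = 0.
Proof. by rewrite compl_partE raddfB ih subrr. Qed.

(* G is the direct sum of i 'F_p and ker h. Here g is a function of 'F_p-valued
   variables x and ker h-valued variables y, ranging independently, and the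
   corresponding operation of G takes values in i 'F_p. *)
Definition fp_op (C : opfam G) (I : Type) (g : (I -> 'F_p) -> (nat -> G) ->
  'F_p) : Prop :=
  clone_op C (fun v : I + nat -> G =>
    i (g (fun j => h (v (inl j))) (fun j => compl_part (v (inr j))))).

Section Clone.
Variable C : opfam G.
Hypothesis aC : clones_above (term_clone (group_algebra G)) C.

Lemma fp_op_ext I (g g' : (I -> 'F_p) -> (nat -> G) -> 'F_p) :
  (forall x y, (forall j, h (y j) = 0) -> g x y = g' x y) ->
  fp_op C g -> fp_op C g'.
Proof.
move=> gg'; congr clone_op; apply: funext => v; congr (i _); apply: gg' => j.
exact: h_compl_part.
Qed.

(** Only linear combinations are substituted for the variables over ker h, because they commute with
    the projection [compl_part]. *)
Lemma fp_op_comp I J (g : (I -> 'F_p) -> (nat -> G) -> 'F_p)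
    (s : I -> (J -> 'F_p) -> (nat -> G) -> 'F_p) (l : nat -> (nat -> G) -> G) :
  fp_op C g -> (forall j, fp_op C (s j)) -> (forall j, lincomb (l j)) ->
  fp_op C (fun x y => g (fun j => s j x y) (fun j => l j y)).
Proof.
move=> Cg Cs Cl.
pose t (j : I + nat) : (J + nat -> G) -> G := match j with
  | inl j => fun v => i (s j (fun k => h (v (inl k)))
    (fun k => compl_part (v (inr k))))
  | inr j => fun v => l j (fun k => v (inr k)) end.
have Ct j : clone_op C (t j).
  case: j => j; first exact: Cs.
  apply: (clone_op_comp (clone_op_lincomb aC (Cl j))) => k;
    exact: clone_op_proj.
have := clone_op_comp Cg Ct; congr clone_op; apply: funext => v;
  congr (i (g _ _)).
  by apply: funext => j /=; rewrite ih.
by apply: funext => j; exact: (lincomb_endo compl_part (fun k => v (inr k))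
  (Cl j)).
Qed.

Lemma fp_op_var I (j : I) : fp_op C (fun x _ => x j).
Proof.
rewrite /fp_op (_ : (fun v => _) = fun v => v (inl j) *+ e).
  by apply: clone_opMn => //; apply: clone_op_proj.
by apply: funext => v.
Qed.

Lemma fp_op_subst I J (g : (I -> 'F_p) -> (nat -> G) -> 'F_p)
    (s : I -> (J -> 'F_p) -> (nat -> G) -> 'F_p) :
  fp_op C g -> (forall j, fp_op C (s j)) ->
    fp_op C (fun x y => g (fun j => s j x y) y).
Proof.
by move=> Cg Cs; apply: (fp_op_comp Cg Cs (l := fun j y => y j)) => j;
  apply: lincomb_proj.
Qed.

Lemma fp_op_rename I J (g : (I -> 'F_p) -> (nat -> G) -> 'F_p) (s : I -> J) :
  fp_op C g -> fp_op C (fun x y => g (fun j => x (s j)) y).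
Proof. by move=> Cg; apply: (fp_op_subst Cg) => j; apply: fp_op_var. Qed.

Lemma fp_op_substy I (g : (I -> 'F_p) -> (nat -> G) -> 'F_p) (l : nat -> (nat ->
  G) -> G) :
  fp_op C g -> (forall j, lincomb (l j)) ->
    fp_op C (fun x y => g x (fun j => l j y)).
Proof.
by move=> Cg Cl; apply: (fp_op_comp Cg (s := fun j x _ => x j)) => // j;
  apply: fp_op_var.
Qed.

Section Linear.
Variable I : Type.
Implicit Types g : (I -> 'F_p) -> (nat -> G) -> 'F_p.

Lemma fp_op0 : fp_op C (fun (_ : I -> 'F_p) _ => 0).
Proof.
have := @clone_op0 G C aC (I + nat)%type; congr clone_op.
by apply: funext => v; rewrite raddf0.
Qed.

Lemma fp_opD g g' : fp_op C g -> fp_op C g' ->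
  fp_op C (fun x y => g x y + g' x y).
Proof.
move=> Cg Cg'; have := clone_opD aC Cg Cg'; congr clone_op.
by apply: funext => v; rewrite raddfD.
Qed.

Lemma fp_opZ c g : fp_op C g -> fp_op C (fun x y => c * g x y).
Proof.
move=> Cg; have := clone_opMn aC c Cg; congr clone_op.
by apply: funext => v; rewrite additive_FpM.
Qed.

Lemma fp_opN g : fp_op C g -> fp_op C (fun x y => - g x y).
Proof.
by move=> /(fp_opZ (-1)); apply: fp_op_ext => x y _; rewrite mulN1r.
Qed.

Lemma fp_opB g g' : fp_op C g -> fp_op C g' ->
  fp_op C (fun x y => g x y - g' x y).
Proof. by move=> Cg Cg'; apply: fp_opD => //; apply: fp_opN. Qed.

Lemma fp_op_sum (J : finType) (g : J -> (I -> 'F_p) -> (nat -> G) -> 'F_p) :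
  (forall j, fp_op C (g j)) -> fp_op C (fun x y => \sum_j g j x y).
Proof.
move=> Cg; elim: (index_enum J) => [|j s IH].
  by apply: fp_op_ext fp_op0 => x y _; rewrite big_nil.
by apply: fp_op_ext (fp_opD (Cg j) IH) => x y _; rewrite big_cons.
Qed.
End Linear.

(** By [polarization], one factor of the power becomes a new variable; the coefficient -(a + 1) is
    invertible as a + 1 < p. *)
Lemma fp_op_polarize_step I (W : (I -> 'F_p) -> (nat -> G) -> 'F_p) a :
  (a.+1 < p)%N ->
  fp_op C (fun (x : option I -> 'F_p) y =>
    x None ^+ a.+1 * W (fun j => x (Some j)) y) ->
  fp_op C (fun (x : option (option I) -> 'F_p) y => x None ^+ a *
    (x (Some None) * W (fun j => x (Some (Some j))) y)).
Proof.
move=> ap CW; have qE : #|'F_p| = p by rewrite card_Fp.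
have a1 : a.+1%:R != 0 :> 'F_p.
  by rewrite -(dvdn_pcharf (pchar_Fp p_pr)) gtnNdvd.
pose s (c : 'F_p) (j : option I) (x : option (option I) -> 'F_p) (y : nat ->
  G) :=
  if j is Some k then x (Some (Some k)) else x None + c * x (Some None).
have Cs c : fp_op C (fun x y => (x None + c * x (Some None))
  ^+ a.+1 * W (fun j => x (Some (Some j))) y).
  apply: (fp_op_subst CW (s := s c)) => -[k|]; first exact: fp_op_var.
  by apply: fp_opD; [|apply: fp_opZ]; apply: fp_op_var.
have := fp_opZ (- a.+1%:R^-1) (fp_op_sum (fun c => fp_opZ (c ^+ #|'F_p|.-2)
  (Cs c))).
apply: fp_op_ext => x y _.
under eq_bigr do rewrite mulrA.
rewrite -mulr_suml polarization ?qE // !mulNr mulrN opprK.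
by rewrite !mulrA mulVf // mul1r.
Qed.

Lemma fp_op_polarize a I (W : (I -> 'F_p) -> (nat -> G) -> 'F_p) :
  (a < p)%N ->
  fp_op C (fun (x : option I -> 'F_p) y =>
    x None ^+ a * W (fun j => x (Some j)) y) ->
  fp_op C (fun (x : nat + I -> 'F_p) y =>
    (\prod_(k < a) x (inl (k : nat))) * W (fun j => x (inr j)) y).
Proof.
elim: a I W => [|a IH] I W ap CW.
  have := fp_op_rename (fun j => if j is Some k then inr k else inl 0%N) CW.
  by apply: fp_op_ext => x y _; rewrite big_ord0 expr0.
have CW' := IH _ (fun x y => x None * W (fun j => x (Some j)) y) (ltnW ap)
  (fp_op_polarize_step ap CW).
pose s (j : nat + option I) : nat + I :=
  match j with inl k => inl k | inr None => inl a | inr (Some j) => inr j end.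
have := fp_op_rename s CW'; apply: fp_op_ext => x y _ /=.
by rewrite big_ord_recr /= mulrA.
Qed.
End Clone.
End FpOp.

(** * Comparing two clones on a primary component *)

Section CloneComparison.
Variables (G : finZmodType) (p : nat) (h : {additive G -> 'F_p}).
Variables (i : {additive 'F_p -> G}) (e m : nat).
Hypotheses (p_pr : prime p) (ih : cancel i h) (ihE : forall x,
  i (h x) = x *+ e).

Definition mono_op (C : opfam G) (d : nat) (r : (nat -> G) -> 'F_p) : Prop :=
  fp_op h i C (fun (x : nat -> 'F_p) y => (\prod_(k < d) x k) * r y).

Section Degrees.
Variable C : opfam G.
Hypothesis aC : clones_above (term_clone (group_algebra G)) C.

Lemma Fp_exp (c : 'F_p) : c ^+ p = c.
Proof. by rewrite -[X in _ ^+ X](card_Fp p_pr) expf_card. Qed.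

(** Identifying p variables replaces p factors with x^p = x; there are p factors to identify because
    d > 0. *)
Lemma mono_op_reduce d r : (0 < d)%N -> mono_op C (d + p.-1) r -> mono_op C d r.
Proof.
case: d => // d _ Cr.
have := fp_op_rename ih ihE aC (fun k => if (k < p)%N then 0%N else (k -
  p.-1)%N) Cr.
apply: fp_op_ext => // x y _.
have -> : (d.+1 + p.-1 = p + d)%N by rewrite addSnnS prednK ?prime_gt0 // addnC.
rewrite big_split_ord /= [in RHS]big_ord_recl /=; congr (_ * _ * _).
  rewrite -[RHS]Fp_exp; under eq_bigr => k _ do rewrite ltn_ord.
  by rewrite prodr_const card_ord.
apply: eq_bigr => k _; rewrite ltnNge leq_addr /= -[in X in (X + k)%N](prednK
  (prime_gt0 p_pr)).
by rewrite addSnnS addKn.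
Qed.

Lemma mono_op_reduce_iter d n r :
  (0 < d)%N -> mono_op C (d + n * p.-1) r -> mono_op C d r.
Proof.
move=> d0; elim: n => [|n IH]; first by rewrite addn0.
by rewrite mulSnr addnA => /(mono_op_reduce (ltn_addr _ d0)).
Qed.

(** Substituting x_1 ... x_(t+1) r for one variable adds t variables and one factor r. *)
Lemma mono_op_exp t r j :
  mono_op C t.+1 r -> mono_op C (j * t).+1 (fun y => r y ^+ j).
Proof.
move=> Cr; elim: j => [|j IH].
  have := @fp_op_var _ _ _ _ _ ihE _ aC nat 0%N; apply: fp_op_ext => // x y _.
  by rewrite big_ord_recr big_ord0 /= mul1r mulr1.
pose s k (x : nat -> 'F_p) (y : nat -> G) :=
  if k is k'.+1 then x (t.+1 + k')%N else (\prod_(l < t.+1) x l) * r y.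
have Cs k : fp_op h i C (s k) by case: k => [|k] //; apply: fp_op_var.
have := fp_op_subst ih aC IH Cs; apply: fp_op_ext => // x y _.
have -> : (j.+1 * t).+1 = (t.+1 + j * t)%N by rewrite mulSn addSn.
rewrite big_split_ord /= [in LHS]big_ord_recl /= exprS.
by rewrite -!mulrA; congr (_ * _); rewrite mulrCA.
Qed.

(* Substituting x_1 ... x_(t+2) r into itself p - 1 times gives the coefficient
   r ^+ p = r in degree p (t+1) + 1. *)
Lemma mono_op_boost t r : mono_op C t.+2 r -> mono_op C (t.+2 + p.-1) r.
Proof.
(* p (t + 1) + 1 = (t + 2 + (p - 1)) + t (p - 1), so t reductions remain. *)
move=> /(mono_op_exp p) Cr; apply: (@mono_op_reduce_iter _ t) => //.
have : mono_op C (p * t.+1).+1 r by apply: fp_op_ext Cr => // x y _;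
  rewrite Fp_exp.
congr (mono_op _ _ _); have := prime_gt0 p_pr; case: p => // q _ /=.
by rewrite mulSn mulnS (mulnC q) addnA !addSn.
Qed.
End Degrees.

(** * Transfer of operations from C to D *)

Variables C D : opfam G.
Hypothesis aC : clones_above (term_clone (group_algebra G)) C.
Hypothesis aD : clones_above (term_clone (group_algebra G)) D.
Hypothesis CD : forall f : op G #|G|.+1, C f -> D f.
Hypothesis p_le : (p <= #|G|)%N.

(** As d <= p <= |G|, the d product variables and the one variable of u fit into |G| + 1 arguments,
    the last of which is kept for u. *)
Lemma mono_op_unary_small d (u : G -> 'F_p) : (d <= p)%N ->
  mono_op C d (fun y => u (y 0%N)) -> mono_op D d (fun y => u (y 0%N)).
Proof.
move=> dp Cu.
pose f (v : 'I_#|G|.+1 -> G) :=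
  i ((\prod_(k < d) h (v (inord k))) * u (compl_part h i (v ord_max))).
have /CD Df : C f.
  apply/(clone_opP aC).
  pose s (j : nat + nat) : 'I_#|G|.+1 :=
    if j is inl k then inord k else ord_max.
  exact: (clone_op_comp Cu (fun j => clone_op_proj (C := C) (s j))).
have {}Df := (clone_opP aD f).1 Df.
pose s (j : 'I_#|G|.+1) : nat + nat :=
  if j == ord_max then inr 0%N else inl (val j).
have := clone_op_comp Df (fun j => clone_op_proj (C := D) (s j)).
congr clone_op; apply: funext => v; rewrite /f /s eqxx; congr (i (_ * _)).
apply: eq_bigr => k _; have kN : (k < #|G|)%N by apply: leq_trans (ltn_ord k)
  (leq_trans dp p_le).
by rewrite -val_eqE /= inordK ?ltnS ?(ltnW kN) // ltn_eqF.
Qed.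

(** For d > p, the degree is lowered by p - 1 in C and raised again in D; the lowered degree is at
    least 2, as [mono_op_boost] requires. *)
Lemma mono_op_unary d (u : G -> 'F_p) :
  mono_op C d (fun y => u (y 0%N)) -> mono_op D d (fun y => u (y 0%N)).
Proof.
have [n] := ubnP d; elim: n d => // n IH d /ltnSE dn Cu.
have [dp|dp] := leqP d p; first exact: mono_op_unary_small.
have p1 := prime_gt1 p_pr.
have [t dE] : exists t, d = (t.+2 + p.-1)%N.
  exists (d - p.+1)%N; rewrite -[LHS](subnK dp); case: (p) p1 => // q _ /=.
  by rewrite !addnS !addSn.
rewrite dE in dn Cu *; apply: mono_op_boost => //; apply: IH.
  by apply: leq_trans dn; rewrite -[X in (X < _)%N]addn0 ltn_add2l -ltnS prednK
    // ltnW.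
exact: mono_op_reduce Cu.
Qed.

Hypothesis hm : forall x, h x = 0 -> x *+ m = 0.
Hypothesis rm : rank_one m (fun r : G -> G -> 'F_p => r).

(** Induction on the number of variables of r: by [rm], the dependence on the last two is a
    combination of functions of single linear forms in them. *)
Lemma mono_op_transfer n d (r : (nat -> G) -> 'F_p) :
  (forall y y', (forall j, (j < n)%N -> y j = y' j) -> r y = r y') ->
  mono_op C d r -> mono_op D d r.
Proof.
(* The bound is relaxed to n + 1 so that the induction starts from unary r. *)
move=> r_dep; have {r_dep} : forall y y', (forall j,
  (j < n.+1)%N -> y j = y' j) -> r y = r y'.
  by move=> y y' yy'; apply: r_dep => j jn; apply: yy'; apply: ltnW.
elim: n r => [|n IH] r r_dep Cr.
  pose u a := r (fun=> a).
  have Eu y : u (y 0%N) = r y by apply: r_dep => -[].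
  have Cu : mono_op C d (fun y => u (y 0%N)) by apply: fp_op_ext Cr => // x y _;
    rewrite Eu.
  by apply: fp_op_ext (mono_op_unary Cu) => // x y _; rewrite Eu.
pose R s t (y : nat -> G) := r (fun j => if j == n then s else if j == n.+1 then
  t else y j).
have RE y : R (y n) (y n.+1) y = r y.
  by congr r; apply: funext => j; case: eqP => [->|_] //; case: eqP => [->|].
suff RP P : rank_one m P ->
    mono_op D d (fun y => P (fun s t => R s t y) (y n) (y n.+1)).
  by apply: fp_op_ext (RP _ rm) => // x y _; rewrite RE.
elim=> {P} [a1 a2 b1 b2|P Q _ DP _ DQ|c P _ DP|P Q PQ _ DP].
(* Merging the two variables in C gives [ra], with one variable fewer; after its transfer, the
   linear form is substituted in D. *)
- pose ra y := R (y n *+ a1) (y n *+ a2) y.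
  have ra_dep y y' : (forall j, (j < n.+1)%N -> y j = y' j) -> ra y = ra y'.
    move=> yy'; rewrite /ra /R yy' //; apply: r_dep => j jn.
    case: eqP => // _; case: eqP => // /eqP jn1.
    by apply: yy'; rewrite ltn_neqAle jn1.
  have Cra : mono_op C d ra.
    pose l j (y : nat -> G) := if j == n then y n *+ a1 else if j == n.+1 then y
      n *+ a2 else y j.
    have Cl j : lincomb (l j).
      rewrite /l; case: eqP => _; first by apply: lincombMn;
        apply: lincomb_proj.
      by case: eqP => _; [apply: lincombMn|]; apply: lincomb_proj.
    exact: (fp_op_substy ih ihE aC Cr Cl).
  pose z (y : nat -> G) := y n *+ b1 + y n.+1 *+ b2.
  pose l j (y : nat -> G) := if j == n then z y else y j.
  have Cl j : lincomb (l j).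
    rewrite /l; case: eqP => _; last exact: lincomb_proj.
    by apply: lincombD; apply: lincombMn; apply: lincomb_proj.
  have := fp_op_substy ih ihE aD (IH _ ra_dep Cra) Cl.
  apply: fp_op_ext => // x y _; congr (_ * _); rewrite /ra /R /l eqxx.
  by congr r; apply: funext => j; case: eqP.
- by apply: fp_op_ext (fp_opD aD DP DQ) => // x y _; rewrite mulrDr.
- by apply: fp_op_ext (fp_opZ aD c DP) => // x y _; rewrite mulrCA.
- by apply: fp_op_ext DP => // x y hy; rewrite PQ //; apply: hm.
Qed.

Definition upd (T : Type) (x : nat -> T) n a j := if j == n then a else x j.

(* Expand g as a polynomial in its last 'F_p-variable; each monomial x^a is
   polarized into a product of a new variables, which joins the product in
   front, and is recovered at the end by identifying these variables. *)
Lemma fp_op_transfer N n d (g : (nat -> 'F_p) -> (nat -> G) -> 'F_p) :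
  (forall x y y', (forall j, (j < N)%N -> y j = y' j) -> g x y = g x y') ->
  (forall x x' y, (forall j, (j < n)%N -> x j = x' j) -> g x y = g x' y) ->
  fp_op h i C (fun (x : nat + nat -> 'F_p) y =>
    (\prod_(k < d) x (inl (k : nat))) * g (fun j => x (inr j)) y) ->
  fp_op h i D (fun (x : nat + nat -> 'F_p) y =>
    (\prod_(k < d) x (inl (k : nat))) * g (fun j => x (inr j)) y).
Proof.
elim: n d g => [|n IH] d g gy gx Cg.
  pose r y := g (fun=> 0) y.
  have gr x y : g x y = r y by apply: gx.
  have Cr : mono_op C d r.
    have := fp_op_rename ih ihE aC (fun j : nat + nat => if j is inl k then k
      else 0%N) Cg.
    by apply: fp_op_ext => // x y _; rewrite gr.
  have := fp_op_rename ih ihE aD (@inl nat nat) (mono_op_transfer (gy _) Cr).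
  by apply: fp_op_ext => // x y _; congr (_ * _); apply: gx.
have upd_dep x x' c y : (forall j,
  (j < n)%N -> x j = x' j) -> g (upd x n c) y = g (upd x' n c) y.
  move=> xx'; apply: gx => j; rewrite /upd ltnS leq_eqVlt.
  by case: eqP => //= _; apply: xx'.
have Cupd c :
    fp_op h i C (fun (x : nat + nat -> 'F_p) y =>
    (\prod_(k < d) x (inl (k : nat))) * g (upd (fun j => x (inr j))
      n (c * x (inr n))) y).
  pose t (j : nat + nat) (x : nat + nat -> 'F_p) (y : nat -> G) :=
    match j with inl k => x (inl k) | inr k => if k == n then c * x (inr n)
      else x (inr k) end.
  have Ct j : fp_op h i C (t j).
    case: j => k; first exact: fp_op_var.
    by rewrite /t; case: eqP => _; [apply: fp_opZ => //|]; apply: fp_op_var.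
  exact: fp_op_subst Cg Ct.
have D0 : fp_op h i D (fun (x : nat + nat -> 'F_p) y =>
    (\prod_(k < d) x (inl (k : nat))) * g (upd (fun j => x (inr j)) n 0) y).
  apply: (IH d (fun x y => g (upd x n 0) y)) => [x y y' yy'|x x' y xx'|].
  - exact: gy.
  - exact: upd_dep.
  - by apply: fp_op_ext (Cupd 0) => // x y _; rewrite mul0r.
pose ga a x y := interp_coef (fun c => g (upd x n c) y) a.
have Da (a : 'I_(#|'F_p|.-1)) : fp_op h i D (fun (x : nat + nat -> 'F_p) y =>
    x (inr n) ^+ a.+1 * ((\prod_(k < d) x (inl (k : nat)))
      * ga a (fun j => x (inr j)) y)).
  have ap : (a.+1 < p)%N.
    apply: (@leq_trans #|'F_p|); last by rewrite card_Fp.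
    by rewrite -[X in (_ < X)%N]prednK ?ltnS // ltnW ?finField_card_gt1.
  have gax x x' y : (forall j, (j < n)%N -> x j = x' j) -> ga a x y = ga a x' y.
    move=> xx'; congr (interp_coef _ a); apply: funext => c; exact: upd_dep.
  have gay x y y' : (forall j, (j < N)%N -> y j = y' j) -> ga a x y = ga a x y'.
    move=> yy'; congr (interp_coef _ a); apply: funext => c; exact: gy.
  have C1 : fp_op h i C (fun (x : nat + nat -> 'F_p) y =>
      x (inr n) ^+ a.+1 * ((\prod_(k < d) x (inl (k : nat)))
        * ga a (fun j => x (inr j)) y)).
    have := fp_opN ih aC (fp_op_sum ih aC (fun c => fp_opZ aC (c ^+ (#|'F_p|.-1
      - a.+1))
      (fp_opB ih aC (Cupd c) (Cupd 0)))).
    apply: fp_op_ext => // x y _.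
    rewrite mulrCA interp_coefM // mulrN mulr_sumr; congr (- _).
    by apply: eq_bigr => c _; rewrite mul0r -mulrBr mulrCA.
  (* The power of x_n is detached as the variable [None]; [ga] is independent of x_n, which [upd]
     overwrites. *)
  have C2 : fp_op h i C (fun (x : option (nat + nat) -> 'F_p) y =>
      x None ^+ a.+1 * ((\prod_(k < d) x (Some (inl (k : nat)))) *
        ga a (fun j => x (Some (inr j))) y)).
    pose s (j : nat + nat) : option (nat + nat) :=
      if j is inr k then if k == n then None else Some j else Some j.
    have := fp_op_rename ih ihE aC s C1; apply: fp_op_ext => // x y _.
    rewrite /s eqxx; congr (_ * (_ * _)); apply: gax => j jn.
    by rewrite ltn_eqF.
  have C3 := fp_op_polarize p_pr ih ihE aC (W :=
    fun (x : nat + nat -> 'F_p) y =>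
    (\prod_(k < d) x (inl (k : nat))) * ga a (fun j => x (inr j)) y) ap C2.
  have C4 : fp_op h i C (fun (x : nat + nat -> 'F_p) y =>
      (\prod_(k < a.+1 + d) x (inl (k : nat))) * ga a (fun j => x (inr j)) y).
    pose s (j : nat + (nat + nat)) : nat + nat :=
      match j with inl k => inl k | inr (inl k)
        => inl (a.+1 + k)%N | inr (inr k) => inr k end.
    have := fp_op_rename ih ihE aC s C3; apply: fp_op_ext => // x y _.
    by rewrite big_split_ord /= mulrA.
  have D4 := IH _ _ gay gax C4.
  pose s (j : nat + nat) : nat + nat :=
    match j with inl k => if (k < a.+1)%N then inr n else inl (k - a.+1)%N | inr
      k => inr k end.
  have := fp_op_rename ih ihE aD s D4; apply: fp_op_ext => // x y _.
  rewrite big_split_ord /= -mulrA; congr (_ * (_ * _)).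
    by under eq_bigr => k _ do rewrite ltn_ord;
      rewrite prodr_const (card_ord a.+1).
  by apply: eq_bigr => k _; rewrite ltnNge leq_addr /= addKn.
have := fp_opD aD D0 (fp_op_sum ih aD Da); apply: fp_op_ext => // x y _.
have updK : upd (fun j => x (inr j)) n (x (inr n)) = fun j => x (inr j).
  by apply: funext => j; rewrite /upd; case: eqP => [->|].
have := interpolation (fun c => g (upd (fun j => x (inr j)) n c) y) (x (inr n)).
rewrite updK => ->; rewrite mulrDr mulr_sumr; congr (_ + _).
by apply: eq_bigr => a _; rewrite mulrCA.
Qed.

(** Each argument is split into independent parts in [i 'F_p] and ker h, the case d = 0 of
    [fp_op_transfer] applies, and the parts are then merged again. *)
Lemma p_part_transfer n (f : op G n.+1) : C f -> D (fun v => f v *+ e).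
Proof.
move=> Cf.
pose g (x : nat -> 'F_p) (y : nat -> G) := h (f (fun j => i (x j) + y j)).
have gx x x' y : (forall j, (j < n.+1)%N -> x j = x' j) -> g x y = g x' y.
  by move=> xx'; congr (h (f _)); apply: funext => j; rewrite xx'.
have gy x y y' : (forall j, (j < n.+1)%N -> y j = y' j) -> g x y = g x y'.
  by move=> yy'; congr (h (f _)); apply: funext => j; rewrite yy'.
have Cg : fp_op h i C (fun (x : nat + nat -> 'F_p) y =>
    (\prod_(k < 0) x (inl (k : nat))) * g (fun j => x (inr j)) y).
  pose t (j : 'I_n.+1) (v : (nat + nat) + nat -> G) :=
    v (inl (inr (j : nat))) *+ e + (v (inr (j : nat)) - v (inr (j : nat)) *+ e).
  have Ct j : clone_op C (t j).
    apply: clone_op_lincomb => //; apply: lincombD.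
      by apply: lincombMn; apply: lincomb_proj.
    apply: lincombD; first exact: lincomb_proj.
    by apply: lincombN; apply: lincombMn; apply: lincomb_proj.
  have := clone_opMn aC e (clone_op_comp ((clone_opP aC f).1 Cf) Ct).
  congr clone_op; apply: funext => v; rewrite big_ord0 mul1r /g ihE;
    congr (f _ *+ e).
  by apply: funext => j; rewrite compl_partE !ihE.
have Dg := fp_op_transfer gy gx Cg.
apply/(clone_opP aD).
pose s (j : (nat + nat) + nat) : 'I_n.+1 :=
  match j with inl (inl k) => inord k | inl (inr k)
    => inord k | inr k => inord k end.
have := clone_op_comp Dg (fun j => clone_op_proj (C := D) (s j)).
congr clone_op; apply: funext => v; rewrite big_ord0 mul1r /g ihE;
  congr (f _ *+ e).
by apply: funext => j; rewrite compl_partE /= inord_val addrC subrK.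
Qed.
End CloneComparison.

(** * Groups of squarefree order *)

Section SquarefreeFinite.
Variable G : finZmodType.
Hypothesis sqf : squarefree #|G|.
Variables C D : opfam G.
Hypothesis aC : clones_above (term_clone (group_algebra G)) C.
Hypothesis aD : clones_above (term_clone (group_algebra G)) D.
Hypothesis CD : forall f : op G #|G|.+1, C f -> D f.

Let G_gt0 : (0 < #|G|)%N.
Proof. by apply/card_gt0P; exists 0. Qed.

Lemma prime_part_transfer p n (f : op G n.+1) :
  prime p -> (p %| #|G|)%N -> C f -> exists2 e,
    ~~ (p %| e)%N & D (fun v => f v *+ e).
Proof.
move=> p_pr pG Cf; have [h [i [m [e [mp ih hm ihE]]]]] :=
  squarefree_Fp_factor p_pr sqf pG.
have mF : m%:R != 0 :> 'F_p.
  rewrite -(dvdn_pcharf (pchar_Fp p_pr)); apply/negP => pm.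
  have p1 : p = 1%N by apply: sqf; rewrite -mp expnS expn1 dvdn_mul.
  by rewrite p1 in p_pr.
have mG : (m %| #|G|)%N by rewrite -mp dvdn_mulr.
exists e.
  apply/negP => /dvdnP[k ek]; have := ihE (i 1).
  rewrite ih ek mulnC mulrnA -(raddfMn i) pchar_Fp_0 // raddf0 mul0rn => i0.
  by have := ih 1; rewrite i0 raddf0 => /eqP; rewrite eq_sym oner_eq0.
exact: (p_part_transfer p_pr ih ihE aC aD CD (dvdn_leq G_gt0 pG) hm
  (rank_one_squarefree sqf mG mF)).
Qed.

(* The integers k with k f in D form an ideal, not contained in any p Z. *)
Lemma clone_transfer : opfam_sub C D.
Proof.
move=> n f Cf; pose P k := `[< (0 < k)%N /\ D (fun v => f v *+ k) >].
have fG v : f v *+ #|G| = 0.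
  by have := @mulrn_card G [set: G]%G (f v) (finset.in_setT _); rewrite cardsT.
have PG : P #|G|.
  apply/asboolP; split=> //.
  apply/(clone_opP aD); have := @clone_op0 _ _ aD 'I_n.+1.
  by congr clone_op; apply: funext => v; rewrite fG.
have [k /asboolP[k0 Dk] k_min] := ex_minnP (ex_intro P _ PG).
have k_dvd a : D (fun v => f v *+ a) -> (k %| a)%N.
  move=> Da; rewrite /dvdn; apply: contraT; rewrite -lt0n => r0.
  have : P (a %% k)%N.
    apply/asboolP; split=> //; apply/(clone_opP aD).
    have := clone_opD aD ((clone_opP aD _).1 Da)
      (clone_opN aD (clone_opMn aD (a %/ k) ((clone_opP aD _).1 Dk))).
    congr clone_op; apply: funext => v.
    by rewrite {1}(divn_eq a k) mulrnDr mulnC mulrnA addrAC subrr add0r.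
  by move/k_min; rewrite leqNgt ltn_pmod.
have [k1|k1] := leqP k 1.
  have {k1}k1 : k = 1%N by apply/eqP; rewrite eqn_leq k1.
  by move: Dk; rewrite k1.
(* A prime divisor of k > 1 divides |G|, and through k also the multiplier e found for that prime, a
   contradiction. *)
have pk := pdiv_prime k1.
have kG : (k %| #|G|)%N by apply: k_dvd; have /asboolP[] := PG.
have [e pe /k_dvd ke] := prime_part_transfer pk (dvdn_trans (pdiv_dvd k) kG) Cf.
by rewrite (dvdn_trans (pdiv_dvd k) ke) in pe.
Qed.
End SquarefreeFinite.

Lemma squarefree_finite_clones (G : finZmodType) :
  squarefree #|G| -> finite_set (clones_above (term_clone (group_algebra G))).
Proof.
move=> sqf; set A := clones_above _.
pose T := {ffun {ffun 'I_#|G|.+1 -> G} -> G}.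
pose code (C : opfam G) : {set T} :=
  finset (fun t : T => `[< C #|G| (fun x => t (finfun x)) >]).
have code_sub C D : A C -> A D -> code C = code D -> opfam_sub C D.
  move=> aC aD CD; apply: clone_transfer => // f Cf.
  pose t : T := [ffun x : {ffun 'I_#|G|.+1 -> G} => f x].
  have tE : (fun x => t (finfun x)) = f.
    by apply: funext => x; rewrite ffunE; congr f; apply: funext => j;
      rewrite ffunE.
  have : t \in code C by rewrite inE; apply/asboolP; rewrite tE.
  by rewrite CD inE => /asboolP; rewrite tE.
have /choice[decode decodeP] : forall s, exists C,
    (exists2 C', A C' & code C' = s) -> A C /\ code C = s.
  move=> s; have [[C AC Cs]|no] := pselect (exists2 C', A C' & code C' = s).
    by exists C.
  (* A set that codes no clone receives the family of all operations as a default value. *)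
  by exists (fun _ _ => True) => /no.
apply: (@sub_finite_set _ _ (range decode)); last first.
  by apply: finite_image; apply: finite_finset.
move=> C AC; have [AD CD] := decodeP (code C) (ex_intro2 _ _ C AC erefl).
by exists (code C) => //; apply: opfam_sub_anti; apply: code_sub.
Qed.

Theorem theorem1p6 (G : finZmodType) :
  (finitely_many_expansions (group_algebra G) <-> squarefree #|G|) /\
  (finitely_many_expansions (group_algebra G) <->
   finite_set (clones_above (term_clone (group_algebra G)))).
Proof.
split; last exact: finitely_many_expansionsP.
apply: (iff_trans (finitely_many_expansionsP _)).
by split; [apply: infinite_not_squarefree | apply: squarefree_finite_clones].
Qed.
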